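(* Let $n>1$ be an integer. \begin{enumerate} \item[(a)] Among angles with vertex at $0$, hyperbolic right angles in $H^n(\mathbb{R})$ coincide with Euclidean right angles in $\mathbb{R}^n$. \item[(b)] For any two hyperbolic right angles $(R_1,a,R_2)$ and $(M_1,b,M_2)$ in $H^n(\mathbb{R})$ there exists a global isometry $u\colon H^n(\mathbb{R})\to H^n(\mathbb{R})$ (with respect to $d_h$) such that $u(R_1)=M_1$, $u(R_2)=M_2$ and $u(a)=b$. \end{enumerate}
   Context: The hyperbolic space is $H^n(\mathbb{R})=\mathbb{R}^n$ with the metric $d_h(x,y)=\cosh^{-1}([x][y]-\langle x,y\rangle)$, where $\langle\cdot,\cdot\rangle$ is the standard inner product, $[x]=\sqrt{1+\|x\|^2}$ with $\|\cdot\|$ the Euclidean norm, and $\cosh^{-1}(t)=\log(t+\sqrt{t^2-1})$ for $t\ge1$. The Euclidean metric on $\mathbb{R}^n$ is $d_e$. An isometry is a surjective distance-preserving map. A hyperbolic line is the image of $\mathbb{R}$ under a distance-preserving map into $(H^n(\mathbb{R}),d_h)$; a closed hyperbolic half-line issuing from $a$ is the image of $[0,\infty)$ under a distance-preserving map sending $0$ to $a$. A hyperbolic angle is an ordered triple $(R_1,a,R_2)$ where $R_1,R_2$ are closed hyperbolic half-lines in $H^n(\mathbb{R})$ issuing from $a$; $a$ is its vertex. Two angles $(R_1,a,R_2)$ and $(M_1,b,M_2)$ are congruent if there is an isometry $u\colon R_1\cup R_2\to M_1\cup M_2$ with $u(R_1)=M_1$, $u(R_2)=M_2$, $u(a)=b$.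 For an angle $(R_1,a,R_2)$, each $R_j$ extends uniquely to a hyperbolic line $L_j$; put $R_j'=(L_j\setminus R_j)\cup\{a\}$. The angle $(R_1,a,R_2)$ is right if the angles $(R_1,a,R_2)$, $(R_2',a,R_1)$, $(R_2,a,R_1')$, $(R_1',a,R_2')$ are pairwise congruent. Euclidean angles, congruence and right angles are defined in the same way in $(\mathbb{R}^n,d_e)$ with $d_e$ in place of $d_h$ (Euclidean lines being the one-dimensional affine subspaces). *)

(* Defs.v *)
From HB Require Import structures.
From mathcomp Require Import all_boot all_order all_algebra.
From mathcomp Require Import all_classical all_reals all_analysis.
Set Implicit Arguments.
Unset Strict Implicit.
Unset Printing Implicit Defensive.
Import Order.TTheory GRing.Theory Num.Theory.
Local Open Scope classical_set_scope.
Local Open Scope ring_scope.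

(* ['rV[R]_n] carries the maximum norm in the library, so the Euclidean norm
   has to be introduced separately. *)
Definition inner (R : realType) (n : nat) (x y : 'rV[R]_n) : R :=
  \sum_(i < n) x 0 i * y 0 i.

Definition enorm (R : realType) (n : nat) (x : 'rV[R]_n) : R :=
  Num.sqrt (inner x x).

Definition d_e (R : realType) (n : nat) (x y : 'rV[R]_n) : R := enorm (x - y).

Definition bracket (R : realType) (n : nat) (x : 'rV[R]_n) : R :=
  Num.sqrt (1 + enorm x ^+ 2).

(* Only meaningful for [1 <= t]; by Cauchy-Schwarz the argument it receives in
   [d_h] is always at least 1. *)
Definition arcosh (R : realType) (t : R) : R := ln (t + Num.sqrt (t ^+ 2 - 1)).

Definition d_h (R : realType) (n : nat) (x y : 'rV[R]_n) : R :=
  arcosh (bracket x * bracket y - inner x y).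

Definition d_R (R : realType) (s t : R) : R := `|s - t|.

(* A map defined on a subset [A] is a total function whose values outside [A]
   are irrelevant. *)
Definition dist_preserving (R : realType) (X Y : Type) (dX : X -> X -> R)
    (dY : Y -> Y -> R) (A : set X) (f : X -> Y) : Prop :=
  forall x y, A x -> A y -> dY (f x) (f y) = dX x y.

Definition isometry_onto (R : realType) (X Y : Type) (dX : X -> X -> R)
    (dY : Y -> Y -> R) (A : set X) (B : set Y) (f : X -> Y) : Prop :=
  dist_preserving dX dY A f /\ f @` A = B.

Definition half_line (R : realType) (X : Type) (d : X -> X -> R) (a : X)
    (H : set X) : Prop :=
  exists f : R -> X,
    isometry_onto (@d_R R) d [set t | 0 <= t] H f /\ f 0 = a.

Definition hyp_line (R : realType) (n : nat) (L : set 'rV[R]_n) : Prop :=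
  exists f : R -> 'rV[R]_n, isometry_onto (@d_R R) (@d_h R n) setT L f.

Definition euc_line (R : realType) (n : nat) (L : set 'rV[R]_n) : Prop :=
  exists p v : 'rV[R]_n, v != 0 /\ L = [set p + t *: v | t in [set: R]].

Record triple (X : Type) := Triple {side1 : set X; vertex : X; side2 : set X}.

Definition is_angle (R : realType) (X : Type) (d : X -> X -> R)
    (A : triple X) : Prop :=
  half_line d (vertex A) (side1 A) /\ half_line d (vertex A) (side2 A).

Definition congruent (R : realType) (X : Type) (d : X -> X -> R)
    (A B : triple X) : Prop :=
  exists u : X -> X,
    [/\ isometry_onto d d (side1 A `|` side2 A) (side1 B `|` side2 B) u,
        u @` side1 A = side1 B,
        u @` side2 A = side2 B
      & u (vertex A) = vertex B].

Definition opposite (X : Type) (L H : set X) (a : X) : set X :=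
  (L `\` H) `|` [set a].

(* The lines [L1], [L2] extending the two sides are unique, so quantifying
   them existentially is the same as choosing them. *)
Definition right_angle (R : realType) (X : Type) (d : X -> X -> R)
    (line : set X -> Prop) (A : triple X) : Prop :=
  is_angle d A /\
  let: Triple R1 a R2 := A in
  exists L1 L2 : set X,
    [/\ line L1, R1 `<=` L1, line L2, R2 `<=` L2 &
        let R1' := opposite L1 R1 a in
        let R2' := opposite L2 R2 a in
        forall B C : triple X,
          [set Triple R1 a R2; Triple R2' a R1;
               Triple R2 a R1'; Triple R1' a R2'] B ->
          [set Triple R1 a R2; Triple R2' a R1;
               Triple R2 a R1'; Triple R1' a R2'] C ->
          congruent d B C].

Definition hyp_right_angle (R : realType) (n : nat) (A : triple 'rV[R]_n) : Prop :=
  right_angle (@d_h R n) (@hyp_line R n) A.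

Definition euc_right_angle (R : realType) (n : nat) (A : triple 'rV[R]_n) : Prop :=
  right_angle (@d_e R n) (@euc_line R n) A.

(* Main.v *)
Require Import Defs.
From mathcomp Require Import all_boot all_order all_algebra.
From mathcomp Require Import all_classical all_reals all_analysis.
From mathcomp Require Import ring lra.
Import Order.TTheory GRing.Theory Num.Theory.
Local Open Scope classical_set_scope.
Local Open Scope ring_scope.

(** At the origin, both d_e and d_h are functions of inner products, and
    conversely distances within a triangle with a vertex at 0 determine inner
    products.  Hence in both geometries the half-lines issuing from 0 are the
    Euclidean rays, and a congruence of (R_1, 0, R_2) with (R_2', 0, R_1) forces
    <v, w> = <-w, v>, i.e. <v, w> = 0, for the unit directions v, w; in the other
    direction, two orthonormal pairs are exchanged by a product of two linear
    reflections.  An arbitrary vertex is moved to 0 by a Lorentz boost. *)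

(** * Inner products, reflections, rays and axes *)

Section InnerProduct.
Context {R : realType} {n : nat}.
Implicit Types (x y z v w m : 'rV[R]_n) (a b c s t : R).

Lemma innerC x y : inner x y = inner y x.
Proof. by apply: eq_bigr => i _; rewrite mulrC. Qed.

Lemma innerDl x y z : inner (x + y) z = inner x z + inner y z.
Proof. by rewrite -big_split; apply: eq_bigr => i _; rewrite mxE mulrDl. Qed.

Lemma innerZl c x y : inner (c *: x) y = c * inner x y.
Proof. by rewrite mulr_sumr; apply: eq_bigr => i _; rewrite mxE mulrA. Qed.

Lemma innerDr x y z : inner x (y + z) = inner x y + inner x z.
Proof. by rewrite innerC innerDl !(innerC _ x). Qed.

Lemma innerZr c x y : inner x (c *: y) = c * inner x y.
Proof. by rewrite innerC innerZl innerC. Qed.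

Lemma innerNl x y : inner (- x) y = - inner x y.
Proof. by rewrite -scaleN1r innerZl mulN1r. Qed.

Lemma innerNr x y : inner x (- y) = - inner x y.
Proof. by rewrite innerC innerNl innerC. Qed.

Lemma inner0l x : inner 0 x = 0.
Proof. by rewrite -(scale0r 0) innerZl mul0r. Qed.

Definition innerE := (innerDl, innerDr, innerNl, innerNr, innerZl, innerZr).

Lemma inner_ge0 x : 0 <= inner x x.
Proof. by apply: sumr_ge0 => i _; rewrite -expr2 sqr_ge0. Qed.

Lemma inner_eq0 x : inner x x = 0 -> x = 0.
Proof.
move=> /psumr_eq0P x0; apply/rowP => i; rewrite mxE; apply/eqP.
by rewrite -sqrf_eq0 expr2 x0 // => j _; rewrite -expr2 sqr_ge0.
Qed.

Lemma inner_eq {x y} : inner (x - y) (x - y) = 0 -> x = y.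
Proof. by move=> /inner_eq0/eqP; rewrite subr_eq0 => /eqP. Qed.

Lemma enorm_sqr x : enorm x ^+ 2 = inner x x.
Proof. by rewrite sqr_sqrtr // inner_ge0. Qed.

Lemma inner_CauchySchwarz x y : inner x y ^+ 2 <= inner x x * inner y y.
Proof.
have [y0|y_neq0] := eqVneq (inner y y) 0.
  by rewrite (inner_eq0 _ y0) innerC !inner0l expr0n /= mulr0.
have y_gt0 : 0 < inner y y by rewrite lt_def y_neq0 inner_ge0.
(* This squared norm equals [inner y y] times the defect in the Cauchy-Schwarz inequality. *)
have := inner_ge0 (inner y y *: x - inner x y *: y).
rewrite !innerE (innerC y x) => h.
rewrite -(ler_pM2l y_gt0); nra.
Qed.

(** Orthogonal reflection in the hyperplane normal to [m]; for [m = 0] it is the identity, so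
    [reflection_swap] also covers [x = y]. *)
Definition reflection m x : 'rV[R]_n := x - (2 * inner x m / inner m m) *: m.

Lemma inner_reflection m x y :
  inner (reflection m x) (reflection m y) = inner x y.
Proof.
rewrite /reflection.
have [m0|m_neq0] := eqVneq (inner m m) 0.
  by rewrite (inner_eq0 _ m0) !scaler0 !subr0.
by rewrite !innerE (innerC m y); field.
Qed.

Lemma reflectionK m : involutive (reflection m).
Proof.
move=> x; rewrite /reflection; have [m0|m_neq0] := eqVneq (inner m m) 0.
  by rewrite (inner_eq0 _ m0) !scaler0 !subr0.
rewrite !innerE -addrA -opprD -scalerDl.
set c := (X in X *: _); suff -> : c = 0 by rewrite scale0r subr0.
by rewrite /c; field.
Qed.

Lemma reflectionZ m c x : reflection m (c *: x) = c *: reflection m x.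
Proof. by rewrite /reflection innerZl scalerBr scalerA; congr (_ - _ *: _); ring. Qed.

Lemma reflection_fix m x : inner x m = 0 -> reflection m x = x.
Proof. by move=> xm; rewrite /reflection xm mulr0 mul0r scale0r subr0. Qed.

Lemma reflection_swap x y : inner x x = inner y y -> reflection (x - y) x = y.
Proof.
move=> xy; rewrite /reflection; have [m0|] := eqVneq (inner (x - y) (x - y)) 0.
  by rewrite (inner_eq m0) subrr scaler0 subr0.
rewrite !innerE (innerC y x) -xy => m_neq0.
set c := (X in X *: _); suff -> : c = 1 by rewrite scale1r subKr.
by rewrite /c; field.
Qed.

(** A first reflection [f] carries [v] to [v']. A second one exchanges [f w] and [w']; both are
    orthogonal to [v'], so it leaves [v'] in place. The right inverse [S] records that [T] is
    onto. *)
Lemma orthonormal_transitive v w v' w' :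
  inner v v = 1 -> inner w w = 1 -> inner v w = 0 ->
  inner v' v' = 1 -> inner w' w' = 1 -> inner v' w' = 0 ->
  exists T S : 'rV[R]_n -> 'rV[R]_n,
    [/\ cancel S T,
        forall x y, inner (T x) (T y) = inner x y,
        forall c x, T (c *: x) = c *: T x,
        T v = v' & T w = w'].
Proof.
move=> vv ww vw vv' ww' vw'.
pose f := reflection (v - v'); pose g := reflection (f w - w').
have fv : f v = v' by apply: reflection_swap; rewrite vv.
have gv : g v' = v'.
  by apply: reflection_fix; rewrite innerDr innerNr vw' -fv inner_reflection vw subr0.
exists (g \o f), (f \o g); split => [x|x y|c x||] /=.
- by rewrite /f /g !reflectionK.
- by rewrite /f /g !inner_reflection.
- by rewrite /f /g !reflectionZ.
- by rewrite fv.
- by apply: reflection_swap; rewrite inner_reflection ww.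
Qed.

Definition ray v : set 'rV[R]_n := [set t *: v | t in [set t | 0 <= t]].

Definition axis v : set 'rV[R]_n := [set t *: v | t in [set: R]].

Lemma ray_id v : ray v v.
Proof. by exists 1; rewrite /= ?ler01 ?scale1r. Qed.

Lemma ray_sub_axis v : ray v `<=` axis v.
Proof. by move=> x [t _ <-]; exists t. Qed.

Lemma image_ray (T : 'rV[R]_n -> 'rV[R]_n) v :
  (forall c x, T (c *: x) = c *: T x) -> T @` ray v = ray (T v).
Proof.
move=> TZ; rewrite image_comp; apply/seteqP.
by split=> x [t t0 <-]; exists t; rewrite //= TZ.
Qed.

Lemma opposite_axis v : v != 0 -> opposite (axis v) (ray v) 0 = ray (- v).
Proof.
move=> v_neq0; apply/seteqP; split=> x.
  case=> [[[t _ <-] nray]|->]; last by exists 0; rewrite /= ?lexx ?scale0r.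
  exists (- t); last by rewrite scalerN scaleNr opprK.
  by rewrite /= oppr_ge0 leNgt; apply/negP => t0; apply: nray; exists t; rewrite //= ltW.
case=> t /= t0 <-; have [->|t_neq0] := eqVneq t 0; first by right; rewrite /= scale0r.
left; split; first by exists (- t); rewrite // scaleNr scalerN.
(* A point on both [ray v] and [ray (- v)] gives [s + t = 0] with both terms nonnegative. *)
case=> s /= s0 /eqP; rewrite scalerN -subr_eq0 opprK -scalerDl scaler_eq0.
rewrite (negPf v_neq0) orbF paddr_eq0 // => /andP[_ /eqP t0'].
by rewrite t0' eqxx in t_neq0.
Qed.

Lemma axis_unique v w : v != 0 -> axis w v -> axis w = axis v.
Proof.
move=> v_neq0 [c _ cw]; have c_neq0 : c != 0.
  by apply: contraNneq v_neq0 => c0; rewrite -cw c0 scale0r.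
apply/seteqP; split=> x [t _ <-].
  by exists (t / c) => //; rewrite -cw scalerA divfK.
by exists (t * c) => //; rewrite -cw scalerA.
Qed.

Lemma unit_neq0 {v} : inner v v = 1 -> v != 0.
Proof. by move=> vv; apply/eqP => v0; move: vv; rewrite v0 inner0l; lra. Qed.

End InnerProduct.

(* What the Euclidean and the hyperbolic metric have in common around 0:
   [sn] is the Euclidean length of a segment issuing from 0 as a function of its
   [d]-length (the identity, resp. sinh), and inner products can be recovered
   from distances within a triangle having 0 as a vertex. *)
Record radial_metric {R : realType} {n : nat} (d : 'rV[R]_n -> 'rV[R]_n -> R)
    (sn : R -> R) : Prop := {
  radial_sn0 : sn 0 = 0;
  radial_sn_ge0 : forall t, 0 <= t -> 0 <= sn t;
  radial_sn_onto : forall r, exists t, sn t = r /\ (0 <= r -> 0 <= t);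
  radial_inner : forall x y x' y', inner x x = inner x' x' ->
    inner y y = inner y' y' -> inner x y = inner x' y' -> d x y = d x' y';
  radial_dist : forall x y x' y', d 0 x = d 0 x' -> d 0 y = d 0 y' ->
    d x y = d x' y' -> inner x y = inner x' y';
  radial_geodesic : forall v s t, inner v v = 1 ->
    d (sn s *: v) (sn t *: v) = `|s - t| }.

(** * Half-lines and right angles at the origin for a radial metric *)

Section RadialMetric.
Context {R : realType} {n : nat} (n_gt0 : (0 < n)%N).
Context {d : 'rV[R]_n -> 'rV[R]_n -> R} {sn : R -> R} (dP : radial_metric d sn).

(** The mutual distances of the points [f t], among them [f 0 = 0], agree with those of the model
    geodesic [sn t *: e], so the Gram matrices agree as well, and these force collinearity. The
    domain [D] allows for both half-lines and lines. *)
Lemma radial_geodesic_unique (D : set R) (f : R -> 'rV[R]_n) :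
  D 0 -> (forall t, 0 <= t -> D t) -> f 0 = 0 ->
  dist_preserving (@d_R R) d D f ->
  exists v, inner v v = 1 /\ forall t, D t -> f t = sn t *: v.
Proof.
move=> D0 Dge0 f0 fD.
have [e ee] : exists e : 'rV[R]_n, inner e e = 1.
  exists (delta_mx 0 (Ordinal n_gt0)).
  rewrite /inner (bigD1 (Ordinal n_gt0)) //= big1 => [|i /negPf ni].
    by rewrite !mxE !eqxx mulr1 addr0.
  by rewrite !mxE ni andbF mulr0.
have d0 s t : D s -> D t -> d (f s) (f t) = d (sn s *: e) (sn t *: e).
  by move=> Ds Dt; rewrite (radial_geodesic _ _ dP) // fD.
have f0E t : D t -> d 0 (f t) = d 0 (sn t *: e).
  by move=> Dt; rewrite -{1}f0 d0 // (radial_sn0 _ _ dP) scale0r.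
have fE s t : D s -> D t -> inner (f s) (f t) = sn s * sn t.
  move=> Ds Dt; rewrite (radial_dist _ _ dP _ _ _ _ (f0E _ Ds) (f0E _ Dt)) ?d0 //.
  by rewrite innerZl innerZr ee mulr1.
(* The direction is the point at Euclidean distance 1 from the origin; its parameter is nonnegative,
   hence in [D]. *)
have [t0 [snt0 /(_ ler01)/Dge0 Dt0]] := radial_sn_onto _ _ dP 1.
exists (f t0); split=> [|t Dt]; first by rewrite fE // snt0 mulr1.
by apply: inner_eq; rewrite !innerE !fE // snt0; ring.
Qed.

Lemma radial_half_lineP (H : set 'rV[R]_n) :
  half_line d 0 H <-> exists v, inner v v = 1 /\ H = ray v.
Proof.
split=> [[f [[fD <-] f0]]|[v [vv ->]]].
  have [v [vv fE]] := radial_geodesic_unique [set t | 0 <= t] f (lexx 0)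
    (fun t t0 => t0) f0 fD.
  exists v; split=> //; apply/seteqP; split=> x [t /= t0 <-].
    by exists (sn t); rewrite ?fE //=; apply: (radial_sn_ge0 _ _ dP).
  have [s [st /(_ t0) s0]] := radial_sn_onto _ _ dP t.
  by exists s; rewrite ?fE ?st.
exists (fun t => sn t *: v); split; last by rewrite (radial_sn0 _ _ dP) scale0r.
split=> [s t _ _|]; first exact: (radial_geodesic _ _ dP).
apply/seteqP; split=> x [t /= t0 <-].
  by exists (sn t); rewrite //=; apply: (radial_sn_ge0 _ _ dP).
by have [s [st /(_ t0) s0]] := radial_sn_onto _ _ dP t; exists s; rewrite ?st.
Qed.

Lemma congruent_orthonormal v w v' w' :
  inner v v = 1 -> inner w w = 1 -> inner v w = 0 ->
  inner v' v' = 1 -> inner w' w' = 1 -> inner v' w' = 0 ->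
  congruent d (Triple (ray v) 0 (ray w)) (Triple (ray v') 0 (ray w')).
Proof.
move=> vv ww vw vv' ww' vw'.
have [T [S [_ Tin TZ Tv Tw]]] := orthonormal_transitive _ _ _ _ vv ww vw vv' ww' vw'.
exists T; rewrite /= !image_ray // Tv Tw; split=> //.
  split=> [x y _ _|]; last by rewrite image_setU !image_ray // Tv Tw.
  exact: (radial_inner _ _ dP).
by rewrite -(scale0r (0 : 'rV[R]_n)) TZ !scale0r.
Qed.

(** The right-hand side mentions neither [d] nor [line], so any two radial metrics have the same
    right angles at 0 once their lines through 0 are the axes. *)
Lemma radial_right_angleP (line : set 'rV[R]_n -> Prop) (R1 R2 : set 'rV[R]_n) :
  (forall v, inner v v = 1 -> line (axis v)) ->
  (forall L, line L -> L 0 -> exists w, L = axis w) ->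
  right_angle d line (Triple R1 0 R2) <->
  exists v w, [/\ inner v v = 1, inner w w = 1, inner v w = 0,
                  R1 = ray v & R2 = ray w].
Proof.
move=> lineA lineP; split.
  move=> [[/= /radial_half_lineP[v [vv ->]] /radial_half_lineP[w [ww ->]]]].
  move=> [L1 [L2 [_ _ lineL2 wL2 congr]]].
  exists v, w; split=> //.
  have L20 : L2 0 by apply: wL2; exists 0; rewrite ?scale0r /=.
  have L2w := wL2 _ (ray_id w).
  have [q L2q] := lineP _ lineL2 L20.
  have L2E : L2 = axis w.
    by rewrite L2q; apply: axis_unique (unit_neq0 ww) _; rewrite -L2q.
  rewrite L2E (opposite_axis _ (unit_neq0 ww)) in congr.
  have [] := congr (Triple (ray v) 0 (ray w)) (Triple (ray (- w)) 0 (ray v)).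
  - by left; left; left.
  - by left; left; right.
  move=> u [[/= uD _] uv uw u0].
  have Av : (ray v `|` ray w) v by left; exact: ray_id.
  have Aw : (ray v `|` ray w) w by right; exact: ray_id.
  have A0 : (ray v `|` ray w) 0 by left; exists 0; rewrite ?scale0r /=.
  (* Since [u] fixes 0, it preserves distances within triangles having 0 as a vertex. *)
  have uin x y : (ray v `|` ray w) x -> (ray v `|` ray w) y ->
      inner (u x) (u y) = inner x y.
    move=> Ax Ay; apply: (radial_dist _ _ dP); last exact: uD.
      by rewrite -{1}u0 uD.
    by rewrite -{1}u0 uD.
  have [s /= s0 uvE] : ray (- w) (u v).
    by rewrite -uv; exists v => //; exact: ray_id.
  have [t /= t0 uwE] : ray v (u w).
    by rewrite -uw; exists w => //; exact: ray_id.
  have := uin _ _ Av Av; have := uin _ _ Aw Aw; have := uin _ _ Av Aw.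
  rewrite -uvE -uwE !innerE vv ww (innerC w v) => h1 h2 h3.
  (* Preservation of norms gives [s ^+ 2 = t ^+ 2 = 1], and the signs are known. *)
  have s1 : s = 1 by nra.
  have t1 : t = 1 by nra.
  by move: h1; rewrite s1 t1; lra.
move=> [v [w [vv ww vw -> ->]]]; split.
  by split; apply/radial_half_lineP; [exists v | exists w].
exists (axis v), (axis w); split; [exact: lineA|exact: ray_sub_axis|
  exact: lineA|exact: ray_sub_axis|].
rewrite /= !opposite_axis ?unit_neq0 // => B C.
(* All four triples are spanned by orthonormal pairs, so a single congruence lemma handles all
   sixteen cases. *)
pose orthonormal_triple A := exists x y, [/\ inner x x = 1, inner y y = 1,
  inner x y = 0 & A = Triple (ray x) (0 : 'rV[R]_n) (ray y)].
suff key A : [set Triple (ray v) 0 (ray w); Triple (ray (- w)) 0 (ray v);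
    Triple (ray w) 0 (ray (- v)); Triple (ray (- v)) 0 (ray (- w))] A ->
    orthonormal_triple A.
  move=> /key[x [y [xx yy xy ->]]] /key[x' [y' [xx' yy' xy' ->]]].
  exact: congruent_orthonormal.
have wv : inner w v = 0 by rewrite innerC.
case=> [[[->|->]|->]|->]; [exists v, w|exists (- w), v|exists w, (- v)|
  exists (- v), (- w)]; by split; rewrite // !innerE ?opprK ?vv ?ww ?vw ?wv ?oppr0.
Qed.

End RadialMetric.

(** * The Euclidean metric is radial *)

Section Euclidean.
Context {R : realType} {n : nat}.
Implicit Types (x y v : 'rV[R]_n).

Lemma d_e_radial : radial_metric (@d_e R n) id.
Proof.
have d_e_sqr x y : d_e x y ^+ 2 = inner x x - 2 * inner x y + inner y y.
  by rewrite enorm_sqr !innerE (innerC y x); ring.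
split=> //.
- by move=> r; exists r.
- move=> x y x' y' xx yy xy; rewrite /d_e /enorm !innerE.
  by rewrite xx yy xy (innerC y x) xy (innerC y' x').
(* Polarization: squared distances are linear in the inner products. *)
- move=> x y x' y' /(congr1 (fun r => r ^+ 2)) h1 /(congr1 (fun r => r ^+ 2)) h2.
  move=> /(congr1 (fun r => r ^+ 2)); move: h1 h2.
  by rewrite !d_e_sqr !inner0l; lra.
- move=> v s t vv; rewrite /d_e /enorm -scalerBl !innerE vv mulr1 -expr2.
  by rewrite sqrtr_sqr.
Qed.

Lemma euc_line_axis v : inner v v = 1 -> euc_line (axis v).
Proof.
move=> /unit_neq0 v_neq0; exists 0, v; split=> //.
by apply/seteqP; split=> x [t _ <-]; exists t; rewrite ?add0r.
Qed.

Lemma euc_line_origin (L : set 'rV[R]_n) : euc_line L -> L 0 -> exists w, L = axis w.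
Proof.
(* The line meets 0 at parameter [c], so [p = - (c *: v)] and shifting the parameter by [c] gives
   the axis. *)
move=> [p [v [_ ->]]] [c _ /eqP]; rewrite addr_eq0 => /eqP ->; exists v.
apply/seteqP; split=> x [t _ <-]; first by exists (t - c) => //; rewrite scalerBl addrC.
by exists (t + c) => //; rewrite scalerDl addrCA addNr addr0.
Qed.

End Euclidean.

(** * Hyperbolic functions and their inverses *)

Section Hyperbolic.
Context {R : realType}.

Definition cosh (t : R) : R := (expR t + expR (- t)) / 2.

Definition sinh (t : R) : R := (expR t - expR (- t)) / 2.

Lemma expR_mulN (t : R) : expR t * expR (- t) = 1.
Proof. by rewrite -expRD subrr expR0. Qed.

Lemma cosh_sqr t : cosh t ^+ 2 = 1 + sinh t ^+ 2.
Proof.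
transitivity (expR t * expR (- t) + sinh t ^+ 2); last by rewrite expR_mulN.
by rewrite /cosh /sinh; field.
Qed.

Lemma cosh_gt0 t : 0 < cosh t.
Proof. by rewrite divr_gt0 // addr_gt0 // expR_gt0. Qed.

Lemma coshB s t : cosh (s - t) = cosh s * cosh t - sinh s * sinh t.
Proof. by rewrite /cosh /sinh opprB !expRD; field. Qed.

Lemma coshN t : cosh (- t) = cosh t.
Proof. by rewrite /cosh opprK addrC. Qed.

Lemma cosh_norm t : cosh `|t| = cosh t.
Proof. by case: (ger0P t) => _ //; rewrite coshN. Qed.

Lemma sinh_ge0 t : 0 <= t -> 0 <= sinh t.
Proof. by move=> t0; rewrite divr_ge0 // subr_ge0 ler_expR; lra. Qed.

Lemma coshK t : arcosh (cosh t) = `|t|.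
Proof.
rewrite -cosh_norm /arcosh cosh_sqr [1 + _]addrC addrK sqrtr_sqr.
rewrite (ger0_norm (sinh_ge0 _ (normr_ge0 t))).
have -> : cosh `|t| + sinh `|t| = expR `|t| by rewrite /cosh /sinh; field.
exact: expRK.
Qed.

Lemma arcoshK (t : R) : 1 <= t -> cosh (arcosh t) = t.
Proof.
move=> t1; have q_ge0 : 0 <= Num.sqrt (t ^+ 2 - 1) := sqrtr_ge0 _.
have q_sqr : Num.sqrt (t ^+ 2 - 1) ^+ 2 = t ^+ 2 - 1 by rewrite sqr_sqrtr //; nra.
rewrite /cosh /arcosh expRN lnK ?posrE; last lra.
have tq_neq0 : t + Num.sqrt (t ^+ 2 - 1) != 0 by apply/eqP; lra.
(* The conjugate is the inverse because the product of the two is 1. *)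
have -> : (t + Num.sqrt (t ^+ 2 - 1))^-1 = t - Num.sqrt (t ^+ 2 - 1).
  by apply: (mulfI tq_neq0); rewrite divff //; lra.
by field.
Qed.

Lemma arcosh_inj (s t : R) : 1 <= s -> 1 <= t -> arcosh s = arcosh t -> s = t.
Proof. by move=> s1 t1 st; rewrite -(arcoshK _ s1) st arcoshK. Qed.

Lemma sinh_onto (r : R) : exists t, sinh t = r /\ (0 <= r -> 0 <= t).
Proof.
pose q := Num.sqrt (1 + r ^+ 2).
have q_ge0 : 0 <= q := sqrtr_ge0 _.
have q_sqr : q ^+ 2 = 1 + r ^+ 2 by rewrite sqr_sqrtr //; nra.
have rq_gt0 : 0 < r + q by nra.
(* The witness is the inverse hyperbolic sine of [r]; for [0 <= r] its logarithm has argument at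
   least 1. *)
exists (ln (r + q)); split; last by move=> r0; apply: ln_ge0; nra.
have rq_neq0 : r + q != 0 by rewrite gt_eqF.
rewrite /sinh expRN lnK ?posrE //.
have -> : (r + q)^-1 = q - r.
  by apply: (mulfI rq_neq0); rewrite divff //; lra.
by field.
Qed.

(** * The hyperbolic metric and its Lorentz boosts *)

Context {n : nat}.
Implicit Types (x y a v : 'rV[R]_n).

Lemma bracketE x : bracket x = Num.sqrt (1 + inner x x).
Proof. by rewrite /bracket enorm_sqr. Qed.

Lemma bracket_sqr x : bracket x ^+ 2 = 1 + inner x x.
Proof. by rewrite bracketE sqr_sqrtr // addr_ge0 // inner_ge0. Qed.

Lemma bracket_ge1 x : 1 <= bracket x.
Proof.
have := bracket_sqr x; have := inner_ge0 x; have : 0 <= bracket x := sqrtr_ge0 _.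
by nra.
Qed.

Lemma bracket0 : bracket (0 : 'rV[R]_n) = 1.
Proof. by rewrite bracketE inner0l addr0 sqrtr1. Qed.

(** Expanding the squared product of brackets and using Cauchy-Schwarz together with
    [0 <= inner (x - y) (x - y)] bounds it below by [(1 + inner x y) ^+ 2]. Hence [d_h] evaluates
    [arcosh] only where it is injective. *)
Lemma lorentz_ge1 x y : 1 <= bracket x * bracket y - inner x y.
Proof.
have cs := inner_CauchySchwarz x y.
have h := inner_ge0 (x - y); rewrite !innerE (innerC y x) in h.
have bx := bracket_ge1 x; have bY := bracket_ge1 y.
have : (bracket x * bracket y) ^+ 2 = (1 + inner x x) * (1 + inner y y).
  by rewrite exprMn !bracket_sqr.
have : 1 <= bracket x * bracket y by nra.
by nra.
Qed.

Lemma d_h_radial : radial_metric (@d_h R n) sinh.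
Proof.
split.
- by rewrite /sinh oppr0 subrr mul0r.
- exact: sinh_ge0.
- exact: sinh_onto.
- by move=> x y x' y' xx yy xy; rewrite /d_h !bracketE xx yy xy.
(* Distances to 0 determine the brackets; the third distance then determines the inner product. *)
- move=> x y x' y' /arcosh_inj h1 /arcosh_inj h2 /arcosh_inj h3.
  have := h1 (lorentz_ge1 _ _) (lorentz_ge1 _ _).
  have := h2 (lorentz_ge1 _ _) (lorentz_ge1 _ _).
  have := h3 (lorentz_ge1 _ _) (lorentz_ge1 _ _).
  by rewrite !inner0l bracket0 !mul1r !subr0 => + yy xx; rewrite xx yy; lra.
- move=> v s t vv; rewrite /d_h.
  (* With this, the Lorentz expression becomes the subtraction formula for [cosh (s - t)]. *)
  have bE r : bracket (sinh r *: v) = cosh r.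
    rewrite bracketE !innerE vv mulr1 -expr2 -cosh_sqr sqrtr_sqr.
    by rewrite ger0_norm // ltW // cosh_gt0.
  by rewrite !bE !innerE vv mulr1 -coshB coshK.
Qed.

Lemma hyp_line_axis v : inner v v = 1 -> hyp_line (axis v).
Proof.
move=> vv; exists (fun t => sinh t *: v); split=> [s t _ _|].
  exact: (radial_geodesic _ _ d_h_radial).
apply/seteqP; split=> x [t _ <-]; first by exists (sinh t).
by have [s [<- _]] := sinh_onto t; exists s.
Qed.

Lemma hyp_line_origin (n_gt0 : (0 < n)%N) (L : set 'rV[R]_n) :
  hyp_line L -> L 0 -> exists w, L = axis w.
Proof.
move=> [f [fD <-]] [t0 _ ft0].
(* Reparametrize so that the line passes through 0 at time 0. *)
have gD : dist_preserving (@d_R R) (@d_h R n) setT (fun t => f (t + t0)).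
  by move=> s t _ _; rewrite fD // /d_R; congr (`|_|); ring.
have g0 : f (0 + t0) = 0 by rewrite add0r.
have [v [_ fE]] := radial_geodesic_unique n_gt0 d_h_radial setT
  (fun t => f (t + t0)) I (fun _ _ => I) g0 gD.
exists v; apply/seteqP; split=> x [t _ <-].
  by exists (sinh (t - t0)); rewrite // -fE // subrK.
by have [s [<- _]] := sinh_onto t; exists (s + t0); rewrite // fE.
Qed.

(* The Lorentz boost carrying the origin (0, 1) of the hyperboloid model
   to (a, [a]), read on the spatial coordinates. *)
Definition translation a x : 'rV[R]_n :=
  x + (bracket x + inner x a / (bracket a + 1)) *: a.

Lemma bracketN a : bracket (- a) = bracket a.
Proof. by rewrite !bracketE !innerE opprK. Qed.

(** This factorization cancels the denominator [bracket a + 1] of the boost, so that [field] can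
    settle the identities below. *)
Lemma inner_bracket a : inner a a = (bracket a - 1) * (bracket a + 1).
Proof. by have := bracket_sqr a; lra. Qed.

Lemma bracketD1_neq0 a : bracket a + 1 != 0.
Proof. by have := bracket_ge1 a => h; apply/eqP; lra. Qed.

(** This is the time coordinate of the boosted point. Both sides are nonnegative, the right one by
    [lorentz_ge1 x (- a)], so their squares are compared. *)
Lemma bracket_translation a x :
  bracket (translation a x) = bracket x * bracket a + inner x a.
Proof.
have := lorentz_ge1 x (- a); rewrite bracketN innerNr opprK => h.
rewrite bracketE -[RHS]ger0_norm; last lra.
rewrite -sqrtr_sqr; congr Num.sqrt; have := bracketD1_neq0 a.
have -> : inner (translation a x) (translation a x) = inner x x +
    2 * (bracket x + inner x a / (bracket a + 1)) * inner x a +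
    (bracket x + inner x a / (bracket a + 1)) ^+ 2 * inner a a.
  by rewrite !innerE (innerC a x); ring.
rewrite (inner_bracket a) (inner_bracket x) => a1.
by field.
Qed.

(** The boost preserves the Lorentz form, that is, the argument of [arcosh] itself. *)
Lemma d_h_translation a x y : d_h (translation a x) (translation a y) = d_h x y.
Proof.
congr arcosh; rewrite !bracket_translation /translation.
by have := bracketD1_neq0 a; rewrite !innerE (innerC a y) inner_bracket => a1; field.
Qed.

Lemma translationK a : cancel (translation a) (translation (- a)).
Proof.
move=> x; rewrite {1}/translation bracketN bracket_translation scalerN.
rewrite innerNr /translation !innerE -addrA -scalerBl.
set c := (X in X *: _); suff -> : c = 0 by rewrite scale0r addr0.
by have := bracketD1_neq0 a; rewrite /c inner_bracket => a1; field.
Qed.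

Lemma translationNK a : cancel (translation (- a)) (translation a).
Proof. by move=> x; rewrite -{1}[a]opprK translationK. Qed.

Lemma translation0 a : translation a 0 = a.
Proof. by rewrite /translation inner0l mul0r addr0 bracket0 scale1r add0r. Qed.

End Hyperbolic.

(** * Transport of angles along a distance-preserving injection *)

Section Transport.
Context {R : realType} {X : Type} {d : X -> X -> R} {line : set X -> Prop}.
Context {f g : X -> X} (fK : cancel f g) (fD : forall x y, d (f x) (f y) = d x y).

Definition map_triple (A : triple X) : triple X :=
  Triple (f @` side1 A) (f (vertex A)) (f @` side2 A).

Lemma half_line_image (a : X) (H : set X) :
  half_line d a H -> half_line d (f a) (f @` H).
Proof.
move=> [h [[hD <-] <-]]; exists (f \o h); split=> //; split; last by rewrite image_comp.
by move=> s t s0 t0; rewrite /= fD hD.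
Qed.

Lemma opposite_image (L H : set X) (a : X) :
  opposite (f @` L) (f @` H) (f a) = f @` opposite L H a.
Proof.
rewrite /opposite image_setU image_set1; congr (_ `|` _).
apply/seteqP; split=> x.
  by move=> [[y Ly <-] nH]; exists y => //; split=> // Hy; apply: nH; exists y.
by move=> [y [Ly nHy] <-]; split; [exists y|move=> [z Hz /(can_inj fK) zy]; rewrite zy in Hz].
Qed.

(** The congruence is conjugated by [f], with [g] undoing [f] on its image. *)
Lemma congruent_image (A B : triple X) :
  congruent d A B -> congruent d (map_triple A) (map_triple B).
Proof.
move=> [u [[uD uAB] u1 u2 ua]].
have fug (C : set X) : (f \o u \o g) @` (f @` C) = f @` (u @` C).
  by rewrite !image_comp; congr (image _); apply/funext => x; rewrite /= fK.
exists (f \o u \o g); split; rewrite /= ?fug ?u1 ?u2 ?fK ?ua //.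
rewrite -!image_setU; split; last by rewrite fug uAB.
by move=> _ _ [x Ax <-] [y Ay <-]; rewrite /= !fK !fD uD.
Qed.

Lemma right_angle_image (A : triple X) :
  (forall L, line L -> line (f @` L)) ->
  right_angle d line A -> right_angle d line (map_triple A).
Proof.
case: A => R1 a R2 lineI [[/= h1 h2] [L1 [L2 [l1 s1 l2 s2 congr]]]].
split; first by split; exact: half_line_image.
exists (f @` L1), (f @` L2); split;
  [exact: lineI|exact: image_subset|exact: lineI|exact: image_subset|].
rewrite /= !opposite_image => B C.
(* The four angles built from the image are the images of the four original ones. *)
have key A : [set Triple (f @` R1) (f a) (f @` R2);
    Triple (f @` opposite L2 R2 a) (f a) (f @` R1);
    Triple (f @` R2) (f a) (f @` opposite L1 R1 a);
    Triple (f @` opposite L1 R1 a) (f a) (f @` opposite L2 R2 a)] A ->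
  exists2 A', [set Triple R1 a R2; Triple (opposite L2 R2 a) a R1;
    Triple R2 a (opposite L1 R1 a);
    Triple (opposite L1 R1 a) a (opposite L2 R2 a)] A' & A = map_triple A'.
  case=> [[[->|->]|->]|->].
  - by exists (Triple R1 a R2) => //; left; left; left.
  - by exists (Triple (opposite L2 R2 a) a R1) => //; left; left; right.
  - by exists (Triple R2 a (opposite L1 R1 a)) => //; left; right.
  - by exists (Triple (opposite L1 R1 a) a (opposite L2 R2 a)) => //; right.
move=> /key[B' B'P ->] /key[C' C'P ->].
by apply: congruent_image; apply: congr.
Qed.

End Transport.

(** * Normal form of hyperbolic right angles, and the two claims *)

Lemma hyp_line_translation {R : realType} {n : nat} (a : 'rV[R]_n) (L : set 'rV[R]_n) :
  hyp_line L -> hyp_line (translation a @` L).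
Proof.
move=> [f [fD <-]]; exists (translation a \o f); split; last by rewrite image_comp.
by move=> s t _ _; rewrite /= d_h_translation fD.
Qed.

(** The boost by [- a] brings the vertex to 0, where right angles are classified; its inverse
    carries the rays back. *)
Lemma hyp_right_angle_standard {R : realType} {n : nat} (n_gt0 : (0 < n)%N)
    (a : 'rV[R]_n) (R1 R2 : set 'rV[R]_n) :
  hyp_right_angle (Triple R1 a R2) ->
  exists v w, [/\ inner v v = 1, inner w w = 1, inner v w = 0,
    R1 = translation a @` ray v & R2 = translation a @` ray w].
Proof.
move=> /(right_angle_image (translationNK a) (d_h_translation (- a)) _
  (hyp_line_translation (- a))).
have a0 : translation (- a) a = 0 by rewrite -{2}(translation0 a) translationK.
rewrite /map_triple /= a0 => /(radial_right_angleP n_gt0 d_h_radial _ _ _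
  hyp_line_axis (hyp_line_origin n_gt0)) [v [w [vv ww vw R1E R2E]]].
have tK (H : set 'rV[R]_n) : translation a @` (translation (- a) @` H) = H.
  rewrite image_comp -[RHS]image_id; congr (image _).
  by apply/funext => x; rewrite /= translationNK.
by exists v, w; split; rewrite // -?R1E -?R2E tK.
Qed.

Theorem proposition4p5 (R : realType) (n : nat) (hn : (1 < n)%N) :
  (forall R1 R2 : set 'rV[R]_n,
      hyp_right_angle (Triple R1 0 R2) <-> euc_right_angle (Triple R1 0 R2)) /\
  (forall (R1 : set 'rV[R]_n) (a : 'rV[R]_n) (R2 : set 'rV[R]_n)
          (M1 : set 'rV[R]_n) (b : 'rV[R]_n) (M2 : set 'rV[R]_n),
      hyp_right_angle (Triple R1 a R2) ->
      hyp_right_angle (Triple M1 b M2) ->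
      exists u : 'rV[R]_n -> 'rV[R]_n,
        [/\ isometry_onto (@d_h R n) (@d_h R n) [set: 'rV[R]_n] [set: 'rV[R]_n] u,
            u @` R1 = M1, u @` R2 = M2 & u a = b]).
Proof.
have n_gt0 : (0 < n)%N := ltnW hn.
split=> [R1 R2|R1 a R2 M1 b M2].
  (* Both notions reduce to the same condition: two rays with orthonormal directions. *)
  rewrite /hyp_right_angle /euc_right_angle.
  rewrite (radial_right_angleP n_gt0 d_h_radial _ _ _ hyp_line_axis
    (hyp_line_origin n_gt0)).
  by rewrite (radial_right_angleP n_gt0 d_e_radial _ _ _ euc_line_axis euc_line_origin).
move=> /(hyp_right_angle_standard n_gt0)[v [w [vv ww vw -> ->]]].
move=> /(hyp_right_angle_standard n_gt0)[v' [w' [vv' ww' vw' -> ->]]].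
have [T [S [SK Tin TZ Tv Tw]]] := orthonormal_transitive _ _ _ _ vv ww vw vv' ww' vw'.
(* Move [a] to 0, match the two orthonormal pairs there, then move 0 to [b]. *)
pose u := translation b \o T \o translation (- a).
have uI (H : set 'rV[R]_n) : u @` (translation a @` H) = translation b @` (T @` H).
  by rewrite !image_comp; congr (image _); apply/funext => x; rewrite /u /= translationK.
exists u; split; [split|by rewrite uI image_ray // Tv|by rewrite uI image_ray // Tw|].
- move=> x y _ _; rewrite /u /= d_h_translation -[RHS](d_h_translation (- a)).
  by apply: (radial_inner _ _ d_h_radial).
- apply/seteqP; split=> // y _.
  exists (translation a (S (translation (- b) y))) => //.
  by rewrite /u /= translationK SK translationNK.
- rewrite /u /= -{2}(translation0 a) translationK.
  by rewrite -(scale0r (0 : 'rV[R]_n)) TZ !scale0r translation0.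
Qed.
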